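(* Let $\mathbf{A}=[\underline{A},\overline{A}]$ be an $n\times n$ interval matrix whose midpoint matrix is the identity, $A_c=I$, and suppose that its radius matrix satisfies $\rho(A_\Delta)<1$. Then the minimum determinant of $\mathbf{A}$ is attained for $\underline{A}$, i.e. $$\min\{\det(A) : A\in\mathbf{A}\}=\det(\underline{A}).$$
   Context: An interval matrix is a set $\mathbf{A}=[\underline{A},\overline{A}]=\{A\in\mathbb{R}^{n\times n} : \underline{A}\le A\le\overline{A}\}$, where $\underline{A}\le\overline{A}$ are real $n\times n$ matrices and inequalities are entrywise. Its midpoint and radius matrices are $A_c=\frac12(\underline{A}+\overline{A})$ and $A_\Delta=\frac12(\overline{A}-\underline{A})$, so $\underline{A}=A_c-A_\Delta$ and $\overline{A}=A_c+A_\Delta$. $\rho(\cdot)$ denotes the spectral radius and $I$ the identity matrix. *)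

(* Defs.v *)
From mathcomp Require Import all_boot all_order all_algebra.
From mathcomp Require Import all_classical all_reals.
From mathcomp.real_closed Require Import complex.

Set Implicit Arguments.
Unset Strict Implicit.
Unset Printing Implicit Defensive.

Import Order.TTheory GRing.Theory Num.Theory.

Local Open Scope classical_set_scope.
Local Open Scope complex_scope.
Local Open Scope ring_scope.

Definition mx_le (R : realType) (n : nat) (A B : 'M[R]_n) : Prop :=
  forall i j, A i j <= B i j.

Definition interval_mx (R : realType) (n : nat) (Al Au : 'M[R]_n) :
    set 'M[R]_n :=
  [set A | mx_le Al A /\ mx_le A Au].

Definition midpoint_mx (R : realType) (n : nat) (Al Au : 'M[R]_n) : 'M[R]_n :=
  2^-1 *: (Al + Au).

Definition radius_mx (R : realType) (n : nat) (Al Au : 'M[R]_n) : 'M[R]_n :=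
  2^-1 *: (Au - Al).

(* The eigenvalues are taken in R[i], and their moduli form a finite set, which
   is nonempty for 0 < n, so that the supremum is a maximum. For n = 0 the set
   is empty and the value is 0. *)
Definition spectral_radius (R : realType) (n : nat) (A : 'M[R]_n) : R :=
  sup [set ComplexField.Normc.normc l | l in
        [set l : R[i] | eigenvalue (map_mx (real_complex R) A) l]].

Definition is_minimum (R : realType) (S : set R) (m : R) : Prop :=
  S m /\ lbound S m.

(* Main.v *)
Require Import Defs.
From mathcomp Require Import all_boot all_order all_algebra.
From mathcomp Require Import all_classical all_reals.
From mathcomp Require Import ring lra.
From mathcomp.real_closed Require Import complex polyrcf.

(** Write D for the radius matrix. As the midpoint is I, the lower bound is
    B = I - D and the members of the interval are the A = I + E with
    |E| <= D entrywise. Since D >= 0 has spectral radius below 1, B is a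
    nonsingular M-matrix, and among the matrices A which it dominates, in the
    sense that B_ii <= A_ii and |A_ij| <= - B_ij for i <> j, it has the least
    determinant (Ostrowski).

    An M-matrix enters the proof as a Z-matrix, that is one with off-diagonal
    entries <= 0, which is semipositive: B v > 0 for some v > 0. This passes to the
    Schur complement of the first diagonal entry ([schur_semipositive]), and so
    does the domination of A by B; as the determinant is the pivot times the
    determinant of the Schur complement, induction on the dimension gives
    0 < det B <= det A ([det_le_dominated]).

    It remains to find v from the hypothesis on the spectral radius
    ([semipositive_of_det_neq0]). That hypothesis excludes real eigenvalues of
    D in [1, +oo[. Consider the t >= 1 for which t I - D is semipositive. They
    form an up-closed set that contains all large t. If s is its infimum, then
    for t > s the vector w(t) = adj(t I - D) 1, where 1 is the all-ones vector,
    is nonnegative and det(t I - D) > 0. Both are polynomial in t, so they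
    remain nonnegative at s, where the determinant is nonzero; since
    (s I - D) w(s) = det(s I - D) 1 > 0, the vector w(s) witnesses
    semipositivity at s. Semipositivity being an open condition, the infimum
    can only be s = 1. *)

Set Implicit Arguments.
Unset Strict Implicit.
Unset Printing Implicit Defensive.

Import Order.TTheory GRing.Theory Num.Theory.

Local Open Scope classical_set_scope.
Local Open Scope ring_scope.

(** * Schur complements *)

Definition schur (F : fieldType) (n : nat) (A : 'M[F]_n.+1) : 'M[F]_n :=
  \matrix_(i, j) (A (lift ord0 i) (lift ord0 j)
                  - A (lift ord0 i) ord0 * A ord0 (lift ord0 j) / A ord0 ord0).

(** One step of block Gaussian elimination, with the first entry as pivot. *)
Lemma det_schur (F : fieldType) (n : nat) (A : 'M[F]_n.+1) :
  A ord0 ord0 != 0 -> \det A = A ord0 ord0 * \det (schur A).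
Proof.
move=> a0; pose M : 'M_(1 + n) := A; pose a := A ord0 ord0.
have M00 : ulsubmx M = a%:M.
  by apply/matrixP=> i j; rewrite !ord1 !mxE eqxx mulr1n /M /a;
     congr (A _ _); apply/val_inj.
have -> : \det A = \det M by [].
rewrite -[M]submxK M00.
have -> : block_mx a%:M (ursubmx M) (dlsubmx M) (drsubmx M) =
  block_mx 1%:M 0 (a^-1 *: dlsubmx M) 1%:M *m
  block_mx a%:M (ursubmx M) 0 (schur A).
  rewrite mulmx_block !mul1mx !mul0mx !addr0.
  congr block_mx.
    by rewrite mul_mx_scalar scalerA divff // scale1r.
  apply/matrixP=> i j; rewrite !mxE big_ord1 !mxE.
  have -> : rshift 1 i = lift ord0 i by apply/val_inj.
  have -> : rshift 1 j = lift ord0 j by apply/val_inj.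
  have -> : lshift n 0 = ord0 :> 'I_(1 + n) by apply/val_inj.
  by rewrite /M /a; field.
by rewrite det_mulmx det_lblock det_ublock !det1 !mul1r det_scalar1.
Qed.

(** * Semipositive Z-matrices and comparison of determinants *)

Definition semipositive (R : numDomainType) (n : nat) (B : 'M[R]_n) : Prop :=
  exists2 v : 'cV[R]_n, (forall i, 0 < v i 0) & forall i, 0 < (B *m v) i 0.

Definition Z_matrix (R : numDomainType) (n : nat) (B : 'M[R]_n) : Prop :=
  forall i j, i != j -> B i j <= 0.

Lemma semipositive_diag_gt0 (R : realFieldType) (n : nat) (B : 'M[R]_n) i :
  Z_matrix B -> semipositive B -> 0 < B i i.
Proof.
move=> zB [v v0 /(_ i)]; rewrite mxE (bigD1 i) //= => Bv.
rewrite -(pmulr_lgt0 _ (v0 i)) (lt_le_trans Bv) // gerDl sumr_le0 // => j ji.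
by rewrite mulr_le0_ge0 ?(ltW (v0 _)) // zB // eq_sym.
Qed.

(** The witness v keeps its last n entries. Row 0 of B v > 0 says that v_0 is
    larger than the value x which solves the equation of row 0 for the first
    unknown, the others being kept. Schur elimination replaces v_0 by x in the
    other rows, and this can only increase them because the coefficients
    B_i0 are <= 0. *)
Lemma schur_semipositive (R : realFieldType) (n : nat) (B : 'M[R]_n.+1) :
  Z_matrix B -> semipositive B -> semipositive (schur B).
Proof.
move=> zB sB; have b0 := semipositive_diag_gt0 ord0 zB sB.
case: sB => v v0 Bv.
exists (\col_i v (lift ord0 i) 0) => i; first by rewrite mxE.
set s := \sum_j B ord0 (lift ord0 j) * v (lift ord0 j) 0.
have Bv0 : 0 < B ord0 ord0 * v ord0 0 + s.
  by have := Bv ord0; rewrite mxE big_ord_recl.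
have -> : (schur B *m \col_k v (lift ord0 k) 0) i 0 =
    \sum_j B (lift ord0 i) (lift ord0 j) * v (lift ord0 j) 0
    - B (lift ord0 i) ord0 / B ord0 ord0 * s.
  rewrite mxE /s mulr_sumr -sumrB; apply: eq_bigr => j _.
  by rewrite !mxE; ring.
have := Bv (lift ord0 i); rewrite mxE big_ord_recl /= => Bvi.
have zi : B (lift ord0 i) ord0 <= 0 by apply: zB.
apply: (lt_le_trans Bvi); rewrite addrC lerD2l.
have -> : B (lift ord0 i) ord0 * v ord0 0 =
  B (lift ord0 i) ord0 / B ord0 ord0 * (B ord0 ord0 * v ord0 0).
  by field; rewrite gt_eqF.
rewrite -subr_le0 opprK -mulrDr mulr_le0_ge0 ?(ltW Bv0) //.
by rewrite mulr_le0_ge0 // invr_ge0 ltW.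
Qed.

(** Ostrowski's comparison. The update a_i0 a_0j / a_00 of the Schur complement
    of A is bounded in modulus by the update b_i0 b_0j / b_00 for B, so each
    elimination step preserves the domination: the diagonal of B loses at least
    as much as that of A, and the moduli of the off-diagonal entries of B grow
    at least as much as those of A. *)
Lemma det_le_dominated (R : realFieldType) (n : nat) (A B : 'M[R]_n) :
  semipositive B -> (forall i, B i i <= A i i) ->
  (forall i j, i != j -> `|A i j| <= - B i j) -> 0 < \det B <= \det A.
Proof.
elim: n => [|n IHn] in A B * => sB dAB oAB.
  by rewrite !det_mx00 ltr01 lexx.
have zB : Z_matrix B.
  by move=> i j /oAB; rewrite lerNr => /le_trans -> //; rewrite oppr_le0.
have b0 := semipositive_diag_gt0 ord0 zB sB.
have a0 : 0 < A ord0 ord0 := lt_le_trans b0 (dAB _).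
have update_le i j :
    `|A (lift ord0 i) ord0 * A ord0 (lift ord0 j) / A ord0 ord0| <=
    B (lift ord0 i) ord0 * B ord0 (lift ord0 j) / B ord0 ord0.
  rewrite !normrM normfV (gtr0_norm a0).
  (* the two off-diagonal entries of B in the product are nonpositive *)
  rewrite -[X in _ <= X / _]mulrNN ler_pM ?mulr_ge0 ?invr_ge0 ?(ltW a0) //.
    by rewrite ler_pM ?oAB.
  by rewrite lef_pV2 // posrE.
have /andP[dB dBA] : 0 < \det (schur B) <= \det (schur A).
  apply: IHn => [|i|i j ij]; first exact: schur_semipositive.
    rewrite !mxE; have := update_le i i; have := dAB (lift ord0 i).
    by rewrite ler_norml => ? /andP[? ?]; lra.
  rewrite !mxE; have := update_le i j.
  have : lift ord0 i != lift ord0 j by rewrite (inj_eq lift_inj).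
  move=> /oAB; have := ler_normB (A (lift ord0 i) (lift ord0 j))
    (A (lift ord0 i) ord0 * A ord0 (lift ord0 j) / A ord0 ord0).
  by lra.
rewrite !det_schur ?gt_eqF // mulr_gt0 //=.
by rewrite ler_pM // ltW.
Qed.

(** Subtract from y the multiple m v with m the least ratio y_i / v_i. If m < 0,
    then at a minimizing row i the remainder y - m v >= 0 vanishes and
    contributes at most 0, while m v contributes m (B v)_i < 0. *)
Lemma Z_matrix_min_principle (R : realFieldType) (n : nat) (B : 'M[R]_n)
    (y : 'cV[R]_n) :
  Z_matrix B -> semipositive B -> (forall i, 0 <= (B *m y) i 0) ->
  forall i, 0 <= y i 0.
Proof.
move=> zB [v v0 Bv] By i0; rewrite leNgt; apply/negP => yi0.
case: (@arg_minP _ _ _ i0 xpredT (fun i => y i 0 / v i 0)) => // i _ imin.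
set m := y i 0 / v i 0 in imin.
have m0 : m < 0.
  by rewrite (le_lt_trans (imin i0 isT)) // pmulr_llt0 // invr_gt0.
pose z := y - m *: v.
have z0 j : 0 <= z j 0.
  by rewrite !mxE subr_ge0 -ler_pdivlMr // imin.
have zi : z i 0 = 0 by rewrite !mxE /m divfK ?subrr // gt_eqF.
have : (B *m y) i 0 < 0.
  have -> : y = z + m *: v by rewrite subrK.
  rewrite mulmxDr -scalemxAr !mxE -[X in _ < X]addr0 ler_ltD //; last first.
    by have := Bv i; rewrite mxE => ?; rewrite nmulr_rlt0.
  apply: sumr_le0 => j _; case: (eqVneq i j) => [<-|ij].
    by rewrite zi mulr0.
  by rewrite mulr_le0_ge0 // zB.
by rewrite ltNge By.
Qed.

(** * The pencil t I - D as polynomials in t *)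

Lemma horner_ge0_right_limit (R : rcfType) (p : {poly R}) (s : R) :
  (forall t, s < t -> 0 <= p.[t]) -> 0 <= p.[s].
Proof.
move=> pge0; rewrite leNgt; apply/negP => ps.
have [|d d0 /(_ (s + d / 2))] := @poly_cont _ s p (- p.[s]).
  by rewrite oppr_gt0.
have half_lt (x : R) : 0 < x -> x / 2 < x by lra.
rewrite addrAC subrr add0r gtr0_norm ?divr_gt0 // => /(_ (half_lt d d0)) pd.
have : p.[s + d / 2] - p.[s] < - p.[s].
  exact: le_lt_trans (ler_norm _) pd.
by rewrite gtrDr ltNge pge0 // ltrDl divr_gt0.
Qed.

Lemma horner_char_poly_mx (R : comNzRingType) (n : nat) (D : 'M[R]_n) (t : R) :
  map_mx (horner_eval t) (char_poly_mx D) = t%:M - D.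
Proof.
by apply/matrixP=> i j; rewrite !mxE /horner_eval hornerD hornerN hornerC
  hornerMn hornerX.
Qed.

Lemma horner_char_poly (R : comNzRingType) (n : nat) (D : 'M[R]_n) (t : R) :
  (char_poly D).[t] = \det (t%:M - D).
Proof. by rewrite -horner_char_poly_mx det_map_mx. Qed.

Lemma horner_adj_char_poly_mx (R : comNzRingType) (n : nat) (D : 'M[R]_n)
    (t : R) i j :
  (\adj (char_poly_mx D) i j).[t] = \adj (t%:M - D) i j.
Proof. by rewrite -horner_char_poly_mx -map_mx_adj [RHS]mxE. Qed.

Lemma Z_matrix_scalar_sub (R : numDomainType) (n : nat) (D : 'M[R]_n) (t : R) :
  (forall i j, 0 <= D i j) -> Z_matrix (t%:M - D).
Proof.
by move=> D0 i j /negbTE ij; rewrite !mxE ij mulr0n add0r oppr_le0.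
Qed.

Lemma scalar_sub_mulcolE (R : comNzRingType) (n : nat) (D : 'M[R]_n) (t : R)
    (v : 'cV[R]_n) i :
  ((t%:M - D) *m v) i 0 = t * v i 0 - (D *m v) i 0.
Proof. by rewrite mulmxBl mul_scalar_mx !mxE. Qed.

(** A semipositive Z-matrix dominates itself. *)
Lemma semipositive_det_gt0 (R : realFieldType) (n : nat) (B : 'M[R]_n) :
  Z_matrix B -> semipositive B -> 0 < \det B.
Proof.
move=> zB sB; suff /andP[] : 0 < \det B <= \det B by [].
by apply: det_le_dominated => // i j ij; rewrite ler0_norm // zB.
Qed.

(** The adjugate is used in place of the inverse because its entries are
    polynomial in t for t I - D, including where t I - D is singular. *)
Lemma adj_mul_ge0 (R : realFieldType) (n : nat) (B : 'M[R]_n) (u : 'cV[R]_n) :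
  Z_matrix B -> semipositive B -> (forall i, 0 <= u i 0) ->
  forall i, 0 <= (\adj B *m u) i 0.
Proof.
move=> zB sB u0; apply: (Z_matrix_min_principle zB sB) => i.
rewrite mulmxA mul_mx_adj mul_scalar_mx mxE mulr_ge0 //.
exact/ltW/semipositive_det_gt0.
Qed.

(** * Semipositivity along the pencil t I - D *)

Lemma semipositive_scalar_sub_le (R : numDomainType) (n : nat) (D : 'M[R]_n)
    (s t : R) :
  s <= t -> semipositive (s%:M - D) -> semipositive (t%:M - D).
Proof.
move=> st [v v0 sv]; exists v => // i; have := sv i.
rewrite !scalar_sub_mulcolE => /lt_le_trans -> //.
by rewrite lerD2r ler_wpM2r // ltW.
Qed.

(** With t larger than every row sum of D, the all-ones vector is a witness. *)
Lemma semipositive_scalar_sub_large (R : realFieldType) (n : nat)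
    (D : 'M[R]_n) :
  (forall i j, 0 <= D i j) ->
  semipositive ((1 + \sum_i \sum_j D i j)%:M - D).
Proof.
move=> D0; exists (const_mx 1) => i; first by rewrite mxE.
rewrite scalar_sub_mulcolE !mxE mulr1 (bigD1 i) //=.
under [X in _ - X]eq_bigr => j _ do rewrite mxE mulr1.
rewrite addrCA [X in X - _]addrC addrK.
by rewrite ltr_pwDl // !sumr_ge0 // => k _; rewrite sumr_ge0.
Qed.

Lemma semipositive_scalar_sub_open (R : realFieldType) (n : nat)
    (D : 'M[R]_n) (s : R) :
  semipositive (s%:M - D) ->
  exists2 e, 0 < e & semipositive ((s - e)%:M - D).
Proof.
case=> v v0 Bv; set w := (s%:M - D) *m v in Bv.
(* 1 / c is smaller than each ratio w_i / v_i, where w = (s I - D) v *)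
pose c := 1 + \sum_i v i 0 / w i 0.
have q0 i : 0 < v i 0 / w i 0 by rewrite divr_gt0.
have c0 : 0 < c by rewrite ltr_pwDl // sumr_ge0 // => i _; exact/ltW.
exists c^-1; first by rewrite invr_gt0.
exists v => // i.
have -> : (((s - c^-1)%:M - D) *m v) i 0 = w i 0 - c^-1 * v i 0.
  by rewrite /w !scalar_sub_mulcolE; ring.
rewrite subr_gt0 ltr_pdivrMl // -ltr_pdivrMr //.
rewrite /c (bigD1 i) //= addrCA ltrDl ltr_pwDl // sumr_ge0 // => j _.
exact/ltW.
Qed.

(** The witness at s is adj(s I - D) applied to the all-ones vector. It is
    nonnegative as a limit from the right; it is positive because
    s w_i = det(s I - D) + (D w)_i. *)
Lemma semipositive_scalar_sub_closed (R : rcfType) (n : nat) (D : 'M[R]_n)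
    (s : R) :
  (forall i j, 0 <= D i j) -> 0 < s -> \det (s%:M - D) != 0 ->
  (forall t, s < t -> semipositive (t%:M - D)) -> semipositive (s%:M - D).
Proof.
move=> D0 s0 ds sT; have zD t := @Z_matrix_scalar_sub _ _ D t D0.
have dets : 0 < \det (s%:M - D).
  rewrite lt_neqAle eq_sym ds -horner_char_poly.
  apply: horner_ge0_right_limit => t st.
  by rewrite horner_char_poly ltW // semipositive_det_gt0 //; exact: sT.
pose w (t : R) : 'cV[R]_n := \adj (t%:M - D) *m const_mx 1.
have ws i : 0 <= w s i 0.
  pose p := \sum_j \adj (char_poly_mx D) i j.
  have pE t : p.[t] = w t i 0.
    rewrite /p horner_sum mxE; apply: eq_bigr => j _.
    by rewrite horner_adj_char_poly_mx [const_mx _ _ _]mxE mulr1.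
  rewrite -pE; apply: horner_ge0_right_limit => t st; rewrite pE.
  by apply: adj_mul_ge0 => // [|j]; [exact: sT | rewrite mxE].
have Bw i : ((s%:M - D) *m w s) i 0 = \det (s%:M - D).
  by rewrite mulmxA mul_mx_adj mul_scalar_mx !mxE mulr1.
exists (w s) => i; last by rewrite Bw.
have Dw : 0 <= (D *m w s) i 0.
  by rewrite mxE sumr_ge0 // => j _; rewrite mulr_ge0.
rewrite -(pmulr_rgt0 _ s0) (lt_le_trans dets) // -(Bw i) scalar_sub_mulcolE.
by rewrite gerBl.
Qed.

(** A form of the Perron-Frobenius theorem. The set T below contains its
    infimum s because D has no real eigenvalue in [1, +oo[; were s > 1, openness
    would put a smaller element into T. *)
Lemma semipositive_of_det_neq0 (R : realType) (n : nat) (D : 'M[R]_n) :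
  (forall i j, 0 <= D i j) ->
  (forall t, 1 <= t -> \det (t%:M - D) != 0) -> semipositive (1%:M - D).
Proof.
move=> D0 dD; pose T := [set t | 1 <= t /\ semipositive (t%:M - D)].
have T1 : lbound T 1 by move=> t [].
have T0 : T !=set0.
  exists (1 + \sum_i \sum_j D i j); split.
    by rewrite lerDl !sumr_ge0 // => i _; rewrite sumr_ge0.
  exact: semipositive_scalar_sub_large.
have infT : has_inf T by split=> //; exists 1.
set s := inf T.
have s1 : 1 <= s by exact: lb_le_inf.
have sT t : s < t -> semipositive (t%:M - D).
  rewrite -subr_gt0 => st; have [u [_ su]] := inf_adherent st infT.
  rewrite addrC subrK => /ltW ut; exact: semipositive_scalar_sub_le su.
have ss : semipositive (s%:M - D).
  apply: semipositive_scalar_sub_closed => //; last exact: dD.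
  exact: lt_le_trans s1.
have [e e0 se] := semipositive_scalar_sub_open ss.
apply: (semipositive_scalar_sub_le _ se); rewrite leNgt; apply/negP => se1.
have /(ge_inf infT.2) : T (s - e) by split=> //; exact: ltW.
by rewrite leNgt -/s ltrBlDr ltrDl e0.
Qed.

(** * Real eigenvalues and the spectral radius *)

Lemma eigenvalue_le_spectral_radius (R : realType) (n : nat) (A : 'M[R]_n)
    (l : R[i]) :
  eigenvalue (map_mx (real_complex R) A) l ->
  ComplexField.Normc.normc l <= spectral_radius A.
Proof.
move=> el; apply: ub_le_sup; last by exists l.
set p := char_poly (map_mx (real_complex R) A).
(* a supremum is an upper bound only of a bounded set; here the moduli are
   bounded by the sum of the moduli of all roots of the characteristic
   polynomial *)
have [rs prs] := closed_field_poly_normal p.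
exists (\sum_(r <- rs) ComplexField.Normc.normc r) => _ [r /= er <-].
have : r \in rs.
  move: er; rewrite eigenvalue_root_char -/p prs.
  by rewrite (monicP (char_poly_monic _)) scale1r root_prod_XsubC.
have n0 (z : R[i]) : 0 <= ComplexField.Normc.normc z.
  by case: z => a b; exact: sqrtr_ge0.
by move=> rrs; rewrite (big_rem r) //= lerDl sumr_ge0.
Qed.

Lemma det_scalar_sub_neq0 (R : realType) (n : nat) (D : 'M[R]_n) (t : R) :
  0 <= t -> spectral_radius D < t -> \det (t%:M - D) != 0.
Proof.
move=> t0 Dt; apply: contraTneq Dt => dt; rewrite -leNgt.
have et : eigenvalue (map_mx (real_complex R) D) (real_complex R t).
  rewrite eigenvalue_root_char -map_char_poly fmorph_root /root.
  by rewrite horner_char_poly dt.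
apply: le_trans (eigenvalue_le_spectral_radius et).
by rewrite /= expr0n addr0 sqrtr_sqr ler_norm.
Qed.

Theorem proposition6p5 (R : realType) (n : nat) (Al Au : 'M[R]_n)
    (hle : mx_le Al Au)
    (hmid : midpoint_mx Al Au = 1%:M)
    (hrad : spectral_radius (radius_mx Al Au) < 1) :
  is_minimum [set \det A | A in interval_mx Al Au] (\det Al).
Proof.
set D := radius_mx Al Au in hrad.
have D0 i j : 0 <= D i j.
  by rewrite !mxE mulr_ge0 ?invr_ge0 // subr_ge0 hle.
have AlE : Al = 1%:M - D.
  by rewrite -hmid; apply/matrixP=> i j; rewrite !mxE; field.
have AuE : Au = 1%:M + D.
  by rewrite -hmid; apply/matrixP=> i j; rewrite !mxE; field.
split; first by exists Al => //; split=> // i j; exact: lexx.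
move=> _ [A [lA uA] <-].
suff /andP[] : 0 < \det Al <= \det A by [].
apply: det_le_dominated => // [|i j ij].
  rewrite AlE; apply: semipositive_of_det_neq0 => // t t1.
  apply: det_scalar_sub_neq0; first exact: le_trans t1.
  exact: lt_le_trans t1.
have := lA i j; have := uA i j.
by rewrite AlE AuE !mxE (negbTE ij) !mulr0n ler_norml => ? ?; lra.
Qed.
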